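(* Let $N\ge1$ be an integer and $\lambda_1,\lambda_2,\lambda_3\in\mathbb{C}$ with $\lambda_1,\lambda_2,\lambda_3\notin\{0,-1,\dots,-(N-1)\}$ and $\lambda_1+\lambda_2,\ \lambda_2+\lambda_3,\ \lambda_1+\lambda_2+\lambda_3\notin\{0,-1,\dots,-(2N-2)\}$. For $l=0,1,\dots,N$ define the polynomials in $x,y,z$ \[v_l=(x+y+z)^{N-l}(x+y)^lP_{N-l}^{\lambda_1+\lambda_2+2l,\lambda_3}\Bigl(\frac{z-(x+y)}{x+y+z}\Bigr)P_l^{\lambda_1,\lambda_2}\Bigl(\frac{y-x}{x+y}\Bigr),\] \[w_l=(x+y+z)^{N-l}(y+z)^lP_{N-l}^{\lambda_1,\lambda_2+\lambda_3+2l}\Bigl(\frac{y+z-x}{x+y+z}\Bigr)P_l^{\lambda_2,\lambda_3}\Bigl(\frac{z-y}{y+z}\Bigr).\] Then, for the operators $X,Y,C'_{123}$ on $\mathbb{C}[x,y,z]$ defined in the context, and for $l=0,\dots,N$, the vectors $v_l$ and $w_l$ are eigenvectors of $X$ and $Y$ respectively: \[Xv_l=l(l+\lambda_1+\lambda_2-1)v_l,\qquad Yw_l=l(l+\lambda_2+\lambda_3-1)w_l,\] and both families are eigenvectors of $C'_{123}$: \[C'_{123}v_l=N(\lambda_1+\lambda_2+\lambda_3+N-1)v_l,\qquad C'_{123}w_l=N(\lambda_1+\lambda_2+\lambda_3+N-1)w_l.\]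
   Context: Jacobi polynomials (shifted parametrisation, usual parameters $\alpha=\lambda-1,\beta=\lambda'-1$): for $\lambda,\lambda'\in\mathbb{C}$, $l\ge0$, \[P^{\lambda,\lambda'}_l(x)=\frac1{2^l}\sum_{s=0}^l(-1)^s\binom{l+\lambda-1}{l-s}\binom{l+\lambda'-1}{s}(1-x)^s(1+x)^{l-s},\] with generalised binomial coefficients $\binom{a}{j}=\frac{a(a-1)\cdots(a-j+1)}{j!}$. $sl_2$ has generators $H,E,F$ with $[H,E]=2E$, $[H,F]=-2F$, $[E,F]=H$; Casimir element $C=\frac{H^2+2H}{4}+FE$; $\delta:U(sl_2)\to U(sl_2)^{\otimes2}$ is the algebra morphism with $\delta(x)=x\otimes1+1\otimes x$ for $x\in sl_2$. Set $C_{12}=\delta(C)\otimes1$, $C_{23}=1\otimes\delta(C)$, $C_{123}=(\delta\otimes\mathrm{Id})\circ\delta(C)$, and \[X=C_{12}-\frac{(\lambda_1+\lambda_2)(\lambda_1+\lambda_2-2)}4,\qquad Y=C_{23}-\frac{(\lambda_2+\lambda_3)(\lambda_2+\lambda_3-2)}4,\] \[C'_{123}=C_{123}-\frac{(\lambda_1+\lambda_2+\lambda_3)(\lambda_1+\lambda_2+\lambda_3-2)}4.\] These are identified with their actions on $\mathbb{C}[x,y,z]$, which realises the tensor product $V_{\lambda_1}\otimes V_{\lambda_2}\otimes V_{\lambda_3}$ of lowest-weight Verma modules: the first tensor factor of $U(sl_2)^{\otimes3}$ acts by $H\mapsto\lambda_1+2x\partial_x$, $E\mapsto x$, $F\mapsto-x\partial_x^2-\lambda_1\partial_x$;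 the second and third factors act by the same formulas with $(x,\lambda_1)$ replaced by $(y,\lambda_2)$ and $(z,\lambda_3)$ respectively. *)

(* Defs.v *)
From HB Require Import structures.
From mathcomp Require Import all_boot all_order all_algebra.
From mathcomp Require Import ring.
From mathcomp Require Export reals complex.
From mathcomp Require Export mpoly.

Set Implicit Arguments.
Unset Strict Implicit.
Unset Printing Implicit Defensive.

Import GRing.Theory.
Local Open Scope ring_scope.

Local Notation "p %:F" := (@tofrac _ p).

(** ** Jacobi polynomials *)

Definition gbinom (K : fieldType) (a : K) (j : nat) : K :=
  (\prod_(i < j) (a - i%:R)) / (j`!)%:R.

Definition jacobi (K : fieldType) (a b : K) (l : nat) : {poly K} :=
  (2 ^+ l)^-1 *: \sum_(s < l.+1)
     ((-1) ^+ s * gbinom (l%:R + a - 1) (l - s) * gbinom (l%:R + b - 1) s)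
       *: ((1 - 'X) ^+ s * (1 + 'X) ^+ (l - s)).

(** [homogenize n p t u] is the element [u ^ n * p (t / u)], which is a polynomial
    expression in [t] and [u] as soon as [p] has degree at most [n]; see
    [tofrac_homogenize] below. *)
Definition homogenize (K : fieldType) (d n : nat) (p : {poly K})
    (t u : {mpoly K[d]}) : {mpoly K[d]} :=
  \sum_(i < n.+1) p`_i *: (t ^+ i * u ^+ (n - i)).

Definition varx (K : fieldType) : {mpoly K[3]} := 'X_(0 : 'I_3).
Definition vary (K : fieldType) : {mpoly K[3]} := 'X_(1 : 'I_3).
Definition varz (K : fieldType) : {mpoly K[3]} := 'X_(2 : 'I_3).

(** The prefactors [(x + y + z) ^ (N - l)] and [(x + y) ^ l] (resp.
    [(y + z) ^ l]) are absorbed in the two homogenisations; [tofrac_v_vec] and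
    [tofrac_w_vec] give the expressions with the rational arguments. *)
Definition v_vec (K : fieldType) (lam1 lam2 lam3 : K) (N l : nat) :
    {mpoly K[3]} :=
  let x := varx K in let y := vary K in let z := varz K in
  homogenize (N - l) (jacobi (lam1 + lam2 + (2 * l)%:R) lam3 (N - l))
        (z - (x + y)) (x + y + z)
  * homogenize l (jacobi lam1 lam2 l) (y - x) (x + y).

Definition w_vec (K : fieldType) (lam1 lam2 lam3 : K) (N l : nat) :
    {mpoly K[3]} :=
  let x := varx K in let y := vary K in let z := varz K in
  homogenize (N - l) (jacobi lam1 (lam2 + lam3 + (2 * l)%:R) (N - l))
        (y + z - x) (x + y + z)
  * homogenize l (jacobi lam2 lam3 l) (z - y) (y + z).

(** [eval_frac p q] is the value of the one-variable polynomial [p] at the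
    rational function [q]. *)
Definition eval_frac (K : fieldType) (d : nat) (p : {poly K})
    (q : {fraction {mpoly K[d]}}) : {fraction {mpoly K[d]}} :=
  (map_poly (fun c : K => (c%:MP_[d])%:F) p).[q].

Lemma size_jacobi (K : fieldType) (a b : K) (l : nat) :
  (size (jacobi a b l) <= l.+1)%N.
Proof.
rewrite /jacobi; apply: leq_trans (size_scale_leq _ _) _.
apply: (leq_trans (size_sum _ _ _)); apply/bigmax_leqP => -[s lts] _ /=.
apply: leq_trans (size_scale_leq _ _) _.
have sl : (s <= l)%N by rewrite -ltnS.
have s1 : (size (1 - 'X : {poly K})%R <= 2)%N.
  by rewrite -opprB size_polyN size_XsubC.
have s2 : (size (1 + 'X : {poly K})%R <= 2)%N.
  by rewrite addrC size_XaddC.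
have e1 (p : {poly K}) k : (size p <= 2 -> size (p ^+ k) <= k.+1)%N.
  move=> hp; apply: leq_trans (size_poly_exp_leq _ _) _; rewrite ltnS.
  by case: (size p) hp => [|[|[|]]] //= _; rewrite mul1n.
apply: leq_trans (size_polyMleq _ _) _.
have := leq_add (e1 _ s s1) (e1 _ (l - s)%N s2).
by rewrite addSn addnS subnKC //; case: (_ + _)%N.
Qed.

Lemma homogenize_term (F : fieldType) (c t u : F) (i n : nat) :
  (i <= n)%N -> u != 0 ->
  c * (t ^+ i * u ^+ (n - i)) = u ^+ n * (c * (t / u) ^+ i).
Proof.
move=> lein u0; rewrite expr_div_n -[in RHS](subnK lein) exprD.
rewrite [RHS]mulrC -!mulrA; congr (_ * (_ * _)).
by rewrite mulrCA mulVf ?mulr1 // expf_neq0.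
Qed.

Lemma tofrac_homogenize (K : fieldType) (d n : nat) (p : {poly K})
    (t u : {mpoly K[d]}) :
  (size p <= n.+1)%N -> u != 0 ->
  (homogenize n p t u)%:F = u%:F ^+ n * eval_frac p (t%:F / u%:F).
Proof.
move=> hp u0; have uF0 : u%:F != 0 by rewrite tofrac_eq0.
pose f : {rmorphism K -> {fraction {mpoly K[d]}}} := (@tofrac _ \o @mpolyC d K).
rewrite /eval_frac -[map_poly _ p]/(map_poly f p).
rewrite (@horner_coef_wide _ n.+1); last by rewrite size_map_poly.
rewrite /homogenize rmorph_sum mulr_sumr; apply: eq_bigr => -[i lti] _ /=.
rewrite coef_map -mul_mpolyC !rmorphM !rmorphXn.
exact: homogenize_term.
Qed.

Lemma vars_neq0 (K : fieldType) :
  [/\ varx K + vary K + varz K != 0, varx K + vary K != 0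
    & vary K + varz K != 0].
Proof.
pose e : 'I_3 -> K := fun i => (i == 1)%:R.
by split; apply/eqP => /(congr1 (meval e));
  rewrite !mevalD !mevalXU meval0 /e /= ?add0r ?addr0 => /eqP;
  rewrite oner_eq0.
Qed.

Lemma tofrac_v_vec (K : fieldType) (lam1 lam2 lam3 : K) (N l : nat) :
  let x := (varx K)%:F in let y := (vary K)%:F in let z := (varz K)%:F in
  (v_vec lam1 lam2 lam3 N l)%:F =
    (x + y + z) ^+ (N - l) * (x + y) ^+ l
    * eval_frac (jacobi (lam1 + lam2 + (2 * l)%:R) lam3 (N - l))
                ((z - (x + y)) / (x + y + z))
    * eval_frac (jacobi lam1 lam2 l) ((y - x) / (x + y)).
Proof.
move=> x y z; have [h1 h2 _] := vars_neq0 K.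
rewrite /v_vec rmorphM /= !tofrac_homogenize ?size_jacobi //.
by rewrite !(tofracD, tofracB, tofracN) [LHS]mulrACA [LHS]mulrA.
Qed.

Lemma tofrac_w_vec (K : fieldType) (lam1 lam2 lam3 : K) (N l : nat) :
  let x := (varx K)%:F in let y := (vary K)%:F in let z := (varz K)%:F in
  (w_vec lam1 lam2 lam3 N l)%:F =
    (x + y + z) ^+ (N - l) * (y + z) ^+ l
    * eval_frac (jacobi lam1 (lam2 + lam3 + (2 * l)%:R) (N - l))
                ((y + z - x) / (x + y + z))
    * eval_frac (jacobi lam2 lam3 l) ((z - y) / (y + z)).
Proof.
move=> x y z; have [h1 _ h2] := vars_neq0 K.
rewrite /w_vec rmorphM /= !tofrac_homogenize ?size_jacobi //.
by rewrite !(tofracD, tofracB, tofracN) [LHS]mulrACA [LHS]mulrA.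
Qed.

(** ** Tensor powers of U(sl_2) and their action on polynomials *)

Inductive sl2_gen := gH | gE | gF.

(** An element of the [n]-th tensor power of U(sl_2) is represented by an
    expression in the generators [Ugen i g], that is, [g] in the [i]-th tensor
    factor and [1] in the others.  The expressions are not quotiented by the
    algebra axioms, by the relations of sl_2 in each factor and by the
    commutation of distinct factors: all the maps below are the homomorphisms
    determined by their values on generators, and only the action on
    polynomials is used.  This action satisfies the relations, see [act_linear],
    [act_HE], [act_HF], [act_EF] and [act_comm]. *)
Inductive Usl2 (K : Type) (n : nat) : Type :=
| Ugen of 'I_n & sl2_gen
| Uscal of K
| Uadd of Usl2 K n & Usl2 K n
| Umul of Usl2 K n & Usl2 K n.

Arguments Ugen {K n}.
Arguments Uscal {K n}.

(** The algebra morphism with prescribed images of the generators. *)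
Fixpoint Umor (K : Type) (m n : nat) (f : 'I_m -> sl2_gen -> Usl2 K n)
    (u : Usl2 K m) : Usl2 K n :=
  match u with
  | Ugen i g => f i g
  | Uscal c => Uscal c
  | Uadd u1 u2 => Uadd (Umor f u1) (Umor f u2)
  | Umul u1 u2 => Umul (Umor f u1) (Umor f u2)
  end.

Definition casimir (K : fieldType) : Usl2 K 1 :=
  let H := Ugen ord0 gH in
  Uadd (Umul (Uscal (4%:R^-1)) (Uadd (Umul H H) (Umul (Uscal 2%:R) H)))
       (Umul (Ugen ord0 gF) (Ugen ord0 gE)).

(** [delta : U -> U (x) U] *)
Definition delta (K : Type) : Usl2 K 1 -> Usl2 K 2 :=
  Umor (fun _ g => Uadd (Ugen 0 g) (Ugen 1 g)).

(** [u |-> u (x) 1] and [u |-> 1 (x) u] *)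
Definition tens_one (K : Type) : Usl2 K 2 -> Usl2 K 3 :=
  Umor (fun i g => Ugen (widen_ord (leqnSn 2) i) g).
Definition one_tens (K : Type) : Usl2 K 2 -> Usl2 K 3 :=
  Umor (fun i g => Ugen (lift ord0 i) g).

(** [delta (x) Id : U (x) U -> U (x) U (x) U] *)
Definition delta_tens_id (K : Type) : Usl2 K 2 -> Usl2 K 3 :=
  Umor (fun i g => if i == 0 then Uadd (Ugen 0 g) (Ugen 1 g) else Ugen 2 g).

Definition C12 (K : fieldType) : Usl2 K 3 := tens_one (delta (casimir K)).
Definition C23 (K : fieldType) : Usl2 K 3 := one_tens (delta (casimir K)).
Definition C123 (K : fieldType) : Usl2 K 3 := delta_tens_id (delta (casimir K)).

Definition Ushift (K : fieldType) (u : Usl2 K 3) (c : K) : Usl2 K 3 :=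
  Uadd u (Uscal (- (c * (c - 2%:R) / 4%:R))).

(** The lowest-weight Verma action of the [i]-th factor on the [i]-th variable:
    [H = lam + 2 x d/dx], [E = x], [F = - x d^2/dx^2 - lam d/dx]. *)
Definition act_gen (K : fieldType) (n : nat) (lam : 'I_n -> K) (i : 'I_n)
    (g : sl2_gen) (p : {mpoly K[n]}) : {mpoly K[n]} :=
  match g with
  | gH => lam i *: p + 2%:R *: ('X_i * p^`M(i))
  | gE => 'X_i * p
  | gF => - ('X_i * p^`M(i)^`M(i)) - lam i *: p^`M(i)
  end.

Fixpoint act (K : fieldType) (n : nat) (lam : 'I_n -> K) (u : Usl2 K n)
    (p : {mpoly K[n]}) : {mpoly K[n]} :=
  match u with
  | Ugen i g => act_gen lam i g p
  | Uscal c => c *: p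
  | Uadd u1 u2 => act lam u1 p + act lam u2 p
  | Umul u1 u2 => act lam u1 (act lam u2 p)
  end.

Lemma act_gen_linear (K : fieldType) (n : nat) (lam : 'I_n -> K) i g :
  linear (act_gen lam i g).
Proof.
by move=> c p q; case: g; rewrite /= -!mul_mpolyC
  ?(mderivD, mderivM, mderivC, mul0r, add0r); ring.
Qed.

Lemma act_linear (K : fieldType) (n : nat) (lam : 'I_n -> K) u :
  linear (act lam u).
Proof.
elim: u => [i g|a|u1 IH1 u2 IH2|u1 IH1 u2 IH2] c p q /=.
- exact: act_gen_linear.
- by rewrite scalerDr !scalerA mulrC.
- by rewrite IH1 IH2 scalerDr addrACA.
- by rewrite IH2 IH1.
Qed.

Lemma mderivXU (K : fieldType) (n : nat) (i j : 'I_n) :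
  ('X_j : {mpoly K[n]})^`M(i) = (j == i)%:R.
Proof.
rewrite mderivX mnm1E; have [->|_] := eqVneq j i; last by rewrite scale0r.
by rewrite scale1r; have -> : (U_(i) - U_(i) = 0 :> 'X_{1..n})%MM;
  [apply/mnmP => k; rewrite mnmBE mnm0E subnn | rewrite mpolyX0].
Qed.

Lemma act_HE (K : fieldType) (n : nat) (lam : 'I_n -> K) i p :
  act lam (Umul (Ugen i gH) (Ugen i gE)) p
  - act lam (Umul (Ugen i gE) (Ugen i gH)) p
  = 2%:R *: act lam (Ugen i gE) p.
Proof.
rewrite /= !scaler_nat -!mul_mpolyC.
rewrite !(mderivD, mderivB, mderivN, mderivMn, mderivM, mderivC, mderivXU).
rewrite ?eqxx /= ?mderivC.
ring.
Qed.

Lemma act_HF (K : fieldType) (n : nat) (lam : 'I_n -> K) i p :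
  act lam (Umul (Ugen i gH) (Ugen i gF)) p
  - act lam (Umul (Ugen i gF) (Ugen i gH)) p
  = - (2%:R *: act lam (Ugen i gF) p).
Proof.
rewrite /= !scaler_nat -!mul_mpolyC.
rewrite !(mderivD, mderivB, mderivN, mderivMn, mderivM, mderivC, mderivXU).
rewrite ?eqxx /= ?mderivC.
ring.
Qed.

Lemma act_EF (K : fieldType) (n : nat) (lam : 'I_n -> K) i p :
  act lam (Umul (Ugen i gE) (Ugen i gF)) p
  - act lam (Umul (Ugen i gF) (Ugen i gE)) p
  = act lam (Ugen i gH) p.
Proof.
rewrite /= !scaler_nat -!mul_mpolyC.
rewrite !(mderivD, mderivB, mderivN, mderivMn, mderivM, mderivC, mderivXU).
rewrite ?eqxx /= ?mderivC.
ring.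
Qed.

Lemma act_comm (K : fieldType) (n : nat) (lam : 'I_n -> K) i j g h p :
  i != j ->
  act lam (Umul (Ugen i g) (Ugen j h)) p
  = act lam (Umul (Ugen j h) (Ugen i g)) p.
Proof.
move=> nij; have ij : (i == j) = false by apply: negbTE.
have ji : (j == i) = false by rewrite eq_sym.
have dc q : q^`M(j)^`M(i) = q^`M(i)^`M(j) by rewrite mderiv_comm.
by case: g; case: h; rewrite /= ?scaler_nat -?mul_mpolyC;
  rewrite ?(mderivD, mderivB, mderivN, mderivMn, mderivM, mderivC, mderivXU);
  rewrite ?ij ?ji /= ?(mderiv0, mul0r, add0r, mderivM, mderivC, mderivXU);
  rewrite ?ij ?ji /= ?(mul0r, add0r) ?dc; ring.
Qed.

Definition eigenvector (K : fieldType) (V : lmodType K) (T : V -> V) (mu : K)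
    (v : V) : Prop :=
  v <> 0 /\ T v = mu *: v.

(** [a] does not belong to [{0, -1, ..., -m}]. *)
Definition avoids (K : fieldType) (a : K) (m : nat) : Prop :=
  forall k : nat, (k <= m)%N -> a <> - k%:R.

Definition weights (K : fieldType) (lam1 lam2 lam3 : K) : 'I_3 -> K :=
  tnth [tuple lam1; lam2; lam3].

Definition opX (K : fieldType) (lam1 lam2 lam3 : K) :
    {mpoly K[3]} -> {mpoly K[3]} :=
  act (weights lam1 lam2 lam3) (Ushift (C12 K) (lam1 + lam2)).

Definition opY (K : fieldType) (lam1 lam2 lam3 : K) :
    {mpoly K[3]} -> {mpoly K[3]} :=
  act (weights lam1 lam2 lam3) (Ushift (C23 K) (lam2 + lam3)).

Definition opC123' (K : fieldType) (lam1 lam2 lam3 : K) :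
    {mpoly K[3]} -> {mpoly K[3]} :=
  act (weights lam1 lam2 lam3) (Ushift (C123 K) (lam1 + lam2 + lam3)).

(* Main.v *)
(** The first factors of [v_l] and [w_l] act on the second ones as polynomials in
    the raising operators: if [p] is a common lowest-weight vector, of weights [a]
    and [b], of two commuting actions of sl_2 with raising operators [E1] and [E2],
    then the homogeneous Jacobi polynomial of degree [n] in [E1], [E2], applied to
    [p], is a lowest-weight vector of weight [a + b + 2 n] for the sum of the two
    actions.  Hence [v_l] is obtained from [1] by coupling the factors 1 and 2, and
    then the result with the factor 3.  The Casimir element acts on a lowest-weight
    vector of weight [mu] by [mu (mu - 2) / 4] and commutes with the raising
    operators, which gives all the eigenvalues; evaluation at a coordinate vector
    shows that the vectors are nonzero. *)
Require Import Defs.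
From mathcomp Require Import all_boot all_order all_algebra.
From mathcomp Require Import reals complex mpoly.
From mathcomp Require Import ring.

Set Implicit Arguments.
Unset Strict Implicit.
Unset Printing Implicit Defensive.

Import GRing.Theory Num.Theory.
Local Open Scope ring_scope.

(** * Abstract actions of sl_2, their sums, and lowest-weight vectors *)

Section Sl2Actions.

Variables (K : numFieldType) (V : lmodType K).
Implicit Types (rho sigma : sl2_gen -> V -> V) (p : V) (a b mu : K).

(** The relations are oriented as rewriting rules that move the raising operator to the left. *)
Record sl2_action rho : Prop := Sl2Action {
  sl2_linear : forall g, linear (rho g);
  sl2_HE : forall p, rho gH (rho gE p) = rho gE (rho gH p) + 2%:R *: rho gE p;
  sl2_EF : forall p, rho gF (rho gE p) = rho gE (rho gF p) - rho gH p }.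

Definition commuting rho sigma :=
  forall g h p, rho g (sigma h p) = sigma h (rho g p).

Definition sum_action rho sigma : sl2_gen -> V -> V :=
  fun g p => rho g p + sigma g p.

Definition cas rho p : V :=
  4%:R^-1 *: (rho gH (rho gH p) + 2%:R *: rho gH p) + rho gF (rho gE p).

Definition lowest rho mu p := rho gF p = 0 /\ rho gH p = mu *: p.

Lemma linear_fD (f : V -> V) : linear f -> {morph f : p q / p + q}.
Proof. by move=> lf p q; have := lf 1 p q; rewrite !scale1r. Qed.

Lemma linear_f0 (f : V -> V) : linear f -> f 0 = 0.
Proof.
by move=> lf; apply: (addrI (f 0)); rewrite -(linear_fD lf) !addr0.
Qed.

Lemma linear_fZ (f : V -> V) c : linear f -> {morph f : p / c *: p}.
Proof. by move=> lf p; have := lf c p 0; rewrite !addr0 linear_f0 // addr0. Qed.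

Lemma linear_fsum (f : V -> V) n (c : 'I_n -> K) (e : 'I_n -> V) :
  linear f -> f (\sum_i c i *: e i) = \sum_i c i *: f (e i).
Proof.
move=> lf; rewrite (big_morph f (linear_fD lf) (linear_f0 lf)).
by apply: eq_bigr => i _; rewrite linear_fZ.
Qed.

Lemma sum_actionP rho sigma :
  sl2_action rho -> sl2_action sigma -> commuting rho sigma ->
  sl2_action (sum_action rho sigma).
Proof.
move=> [lr HEr EFr] [ls HEs EFs] rs; split; rewrite /sum_action.
- by move=> g c p q; rewrite lr ls scalerDr addrACA.
- move=> p; rewrite !(linear_fD (lr _)) !(linear_fD (ls _)) HEr HEs -!rs !scalerDr.
  by rewrite [LHS](AC (3*(1*2)) ((1*4)*(3*5)*(2*6))).
- move=> p; rewrite !(linear_fD (lr _)) !(linear_fD (ls _)) EFr EFs !rs opprD.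
  by rewrite [LHS](AC (3*(1*2)) ((1*4)*(3*5)*(2*6))).
Qed.

Lemma commuting_sym rho sigma : commuting rho sigma -> commuting sigma rho.
Proof. by move=> rs g h p; rewrite rs. Qed.

Lemma commuting_suml rho sigma tau :
  (forall g, linear (tau g)) ->
  commuting rho tau -> commuting sigma tau -> commuting (sum_action rho sigma) tau.
Proof. by move=> lt rt st g h p; rewrite /sum_action rt st (linear_fD (lt h)). Qed.

(** [w_vec] couples 1 with (2, 3), whereas [C123] is bracketed as ((1, 2), 3). *)
Lemma lowest_sum_actionA rho sigma tau mu p :
  lowest (sum_action rho (sum_action sigma tau)) mu p ->
  lowest (sum_action (sum_action rho sigma) tau) mu p.
Proof. by rewrite /lowest /sum_action !addrA. Qed.

Lemma iter_HE rho mu p s : sl2_action rho -> lowest rho mu p ->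
  rho gH (iter s (rho gE) p) = (mu + (2 * s)%:R) *: iter s (rho gE) p.
Proof.
move=> [lr HE _] [_ Hp]; elim: s => [|s IH] /=; first by rewrite addr0.
rewrite HE IH (linear_fZ _ (lr _)) -scalerDl; congr (_ *: _).
by rewrite mulnS natrD; ring.
Qed.

(** Moving F past each E subtracts a weight; the weights mu, mu + 2, ..., mu + 2(s - 1) add up to
    s(s - 1 + mu). For s = 0 this scalar vanishes, so the value of [s.-1] is harmless. *)
Lemma iter_FE rho mu p s : sl2_action rho -> lowest rho mu p ->
  rho gF (iter s (rho gE) p) = - (s%:R * (s%:R - 1 + mu)) *: iter s.-1 (rho gE) p.
Proof.
move=> rhoP [Fp Hp]; elim: s => [|s IH] /=.
  by rewrite Fp mul0r oppr0 scale0r.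
rewrite sl2_EF // IH (iter_HE s rhoP (conj Fp Hp)) (linear_fZ _ (sl2_linear rhoP _)).
case: s IH => [|s] /= _.
  by rewrite mul0r oppr0 scale0r sub0r -scaleNr; congr (_ *: _); ring.
by rewrite -scalerBl; congr (_ *: _); ring.
Qed.

Lemma cas_lowest rho mu p : sl2_action rho -> lowest rho mu p ->
  cas rho p = (mu * (mu - 2%:R) / 4%:R) *: p.
Proof.
move=> rhoP [Fp Hp]; have lr := sl2_linear rhoP.
rewrite /cas sl2_EF // Fp (linear_f0 (lr _)) !(Hp, linear_fZ _ (lr _)) sub0r.
by rewrite !scalerA -scalerDl scalerA -scaleNr -scalerDl; congr (_ *: _); field.
Qed.

Lemma cas_linear rho : sl2_action rho -> linear (cas rho).
Proof.
move=> rhoP c p q; have lr := sl2_linear rhoP.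
rewrite /cas !(linear_fD (lr _)) !(linear_fZ _ (lr _)).
rewrite !scalerDr !scalerA [2%:R * c]mulrC mulrCA mulrA [4%:R^-1 * c]mulrC.
by rewrite [LHS](AC ((2*2)*2) ((1*3*5)*((2*4)*6))).
Qed.

(** Since HE = E(H + 2), the part (H^2 + 2H)/4 produces the extra term E(H + 2), which cancels the
    -HE coming from FEE = EFE - HE. *)
Lemma cas_E rho : sl2_action rho ->
  forall p, cas rho (rho gE p) = rho gE (cas rho p).
Proof.
move=> rhoP p; have lr := sl2_linear rhoP.
rewrite /cas sl2_EF // sl2_HE // !(linear_fD (lr _)) !(linear_fZ _ (lr _)).
rewrite !sl2_HE // !(linear_fD (lr _)) !(linear_fZ _ (lr _)).
(* [W] is E(H + 2)p, that is HEp; keeping it opaque leaves only its multiples to compare. *)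
set W := rho gE (rho gH p) + _; rewrite -!addrA -!scalerDr addrA.
move: W => W; rewrite -mulr2n -scaler_nat !scalerDr !scalerA.
have -> : 4%:R^-1 * (2%:R * 2%:R) = 1 :> K by field.
by rewrite scale1r [LHS](AC ((1*2)*1*1) ((1*2*4)*(3*5))) /= subrr addr0.
Qed.

Lemma cas_comm rho sigma h : linear (sigma h) -> commuting rho sigma ->
  forall p, cas rho (sigma h p) = sigma h (cas rho p).
Proof. by move=> ls rs p; rewrite /cas !rs !(linear_fD ls, linear_fZ _ ls). Qed.

(** * Jacobi polynomials in two commuting raising operators *)

(** The coefficients of [jacobi] without the factor 2^-n, which homogenisation cancels. *)
Definition jacobi_coef a b n s : K :=
  (-1) ^+ s * gbinom (n%:R + a - 1) (n - s) * gbinom (n%:R + b - 1) s.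

Definition jacobi_vec rho sigma a b n p : V :=
  \sum_(s < n.+1) jacobi_coef a b n s
     *: iter s (rho gE) (iter (n - s) (sigma gE) p).

Lemma gbinomS a j : gbinom a j.+1 * j.+1%:R = gbinom a j * (a - j%:R).
Proof.
rewrite /gbinom big_ord_recr /= factS natrM.
by field; rewrite nat1r !pnatr_eq0 -lt0n fact_gt0.
Qed.

(** Going from s to s + 1 removes the factor s + a from the first binomial and adds the factor n - s
    - 1 + b to the second. This recurrence is what makes the lowering operator kill [jacobi_vec]. *)
Lemma jacobi_coefS a b n s : (s < n)%N ->
  jacobi_coef a b n s.+1 * (s.+1%:R * (s%:R + a))
  = - (jacobi_coef a b n s * ((n - s)%:R * ((n - s)%:R - 1 + b))).
Proof.
move=> lt_sn; rewrite /jacobi_coef.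
have -> : (n - s = (n - s.+1).+1)%N by rewrite subnSK.
set m := (n - s.+1)%N; have En : n = (m + s.+1)%N by rewrite subnK.
have Ea := gbinomS (n%:R + a - 1) m; have Eb := gbinomS (n%:R + b - 1) s.
transitivity ((-1) ^+ s.+1 * (gbinom (n%:R + a - 1) m * (s%:R + a))
              * (gbinom (n%:R + b - 1) s.+1 * s.+1%:R)); first by ring.
have -> : s%:R + a = n%:R + a - 1 - m%:R by rewrite En; ring.
rewrite -Ea Eb exprS.
have -> : n%:R + b - 1 - s%:R = m.+1%:R - 1 + b by rewrite En; ring.
by ring.
Qed.

Lemma iter_lowest rho sigma b p s : sl2_action rho -> commuting sigma rho ->
  lowest sigma b p -> lowest sigma b (iter s (rho gE) p).
Proof.
move=> rhoP sr Lp; elim: s => //= s [IF IH].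
have lr := sl2_linear rhoP gE.
by split; rewrite sr ?IF ?IH ?(linear_f0 lr) ?(linear_fZ _ lr).
Qed.

Lemma iter_comm (f g : V -> V) p s :
  (forall q, f (g q) = g (f q)) -> f (iter s g p) = iter s g (f p).
Proof. by move=> fg; elim: s => //= s IH; rewrite fg IH. Qed.

Lemma iterZ (f : V -> V) c p s : linear f -> iter s f (c *: p) = c *: iter s f p.
Proof. by move=> lf; apply/esym/iter_comm => q; rewrite linear_fZ. Qed.

Lemma lowest_jacobi_vec rho sigma a b n p :
  sl2_action rho -> sl2_action sigma -> commuting rho sigma ->
  lowest rho a p -> lowest sigma b p ->
  lowest (sum_action rho sigma) (a + b + (2 * n)%:R)
    (jacobi_vec rho sigma a b n p).
Proof.
move=> rhoP sigP rs La Lb.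
have lr := sl2_linear rhoP; have ls := sl2_linear sigP.
have sr := commuting_sym rs.
have La' k := iter_lowest k sigP rs La.
split; rewrite /sum_action /jacobi_vec (linear_fsum _ _ (lr _));
  rewrite (linear_fsum _ _ (ls _)).
(* The first sum loses its term s = 0 and the second its term s = n, both killed by F. Term i + 1 of
   the first then meets term i of the second on the same vector E1^i E2^(n-1-i) p. *)
- rewrite [X in X + _]big_ord_recl [X in _ + X]big_ord_recr /=.
  rewrite (La' _).1 scaler0 add0r subnn.
  have -> : sigma gF (iter n (rho gE) p) = 0 by rewrite (iter_lowest n rhoP sr Lb).1.
  rewrite scaler0 addr0 -big_split /= big1 // => i _.
  rewrite -[rho gE (iter _ _ _)]/(iter i.+1 (rho gE) _) (iter_FE _ rhoP (La' _)).
  rewrite (iter_comm _ _ (sr gF gE)) (iter_FE _ sigP Lb) iterZ //= -subnS.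
  rewrite !scalerA -scalerDl !mulrN -opprD [i.+1%:R - 1]addrC -nat1r addKr.
  by rewrite nat1r jacobi_coefS ?ltn_ord // addNr oppr0 scale0r.
- rewrite -big_split scaler_sumr; apply: eq_bigr => i _ /=.
  rewrite (iter_HE _ rhoP (La' _)) (iter_comm _ _ (sr gH gE)).
  rewrite (iter_HE _ sigP Lb) (iterZ _ _ _ (lr _)).
  rewrite !scalerA -scalerDl -mulrDr mulrC addrACA -natrD -mulnDr subnKC //.
  by rewrite -ltnS.
Qed.

Lemma jacobi_vec_eigen (f : V -> V) rho sigma a b n p mu :
  linear f -> linear (rho gE) -> linear (sigma gE) ->
  (forall q, f (rho gE q) = rho gE (f q)) ->
  (forall q, f (sigma gE q) = sigma gE (f q)) ->
  f p = mu *: p ->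
  f (jacobi_vec rho sigma a b n p) = mu *: jacobi_vec rho sigma a b n p.
Proof.
move=> lf lr ls fr fs fp; rewrite /jacobi_vec linear_fsum // scaler_sumr.
apply: eq_bigr => i _; rewrite (iter_comm _ _ fr) (iter_comm _ _ fs) fp.
by rewrite (iterZ _ _ _ ls) (iterZ _ _ _ lr) !scalerA mulrC.
Qed.

Lemma lowest_jacobi_vec_comm rho sigma tau a b n mu p :
  sl2_action rho -> sl2_action sigma -> sl2_action tau ->
  commuting tau rho -> commuting tau sigma ->
  lowest tau mu p -> lowest tau mu (jacobi_vec rho sigma a b n p).
Proof.
move=> rhoP sigP tauP tr ts [Fp Hp]; split; last first.
  by apply: jacobi_vec_eigen => //; exact: sl2_linear.
(* Being killed by F is treated as having eigenvalue 0. *)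
rewrite -[RHS](scale0r (jacobi_vec rho sigma a b n p)).
by apply: jacobi_vec_eigen; rewrite ?scale0r //; exact: sl2_linear.
Qed.

End Sl2Actions.

(** * Homogenised Jacobi polynomials and the action on polynomials *)

(** At X = (u - t)/(t + u) one has 1 - X = 2t/(t + u) and 1 + X = 2u/(t + u), so all powers of 2 and
    of t + u cancel. *)
Lemma horner_jacobi (K : numFieldType) (F : fieldType) (f : {rmorphism K -> F})
    (a b : K) (m : nat) (t u : F) : t + u != 0 ->
  (t + u) ^+ m * (map_poly f (jacobi a b m)).[(u - t) / (t + u)]
  = \sum_(s < m.+1) f (jacobi_coef a b m s) * (t ^+ s * u ^+ (m - s)).
Proof.
move=> w0; have two0 : 2%:R != 0 :> F.
  by rewrite -(rmorph_nat f) fmorph_eq0 pnatr_eq0.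
rewrite /jacobi map_polyZ /= rmorph_sum hornerZ horner_sum !mulr_sumr.
apply: eq_bigr => -[s lts] _ /=; have les : (s <= m)%N by rewrite -ltnS.
rewrite -/(jacobi_coef a b m s); set c := jacobi_coef _ _ _ _.
rewrite map_polyZ hornerZ fmorphV rmorphXn rmorph_nat.
rewrite [map_poly f _]rmorphM /= hornerM !rmorphXn /= !horner_exp.
rewrite rmorphB rmorphD /= !rmorph1 map_polyX !(hornerD, hornerN, hornerX, hornerC).
have -> : 1 - (u - t) / (t + u) = 2%:R * t / (t + u) by field.
have -> : 1 + (u - t) / (t + u) = 2%:R * u / (t + u) by field.
rewrite !expr_div_n !exprMn -{1 2}(subnKC les) !exprD.
by field; rewrite !expf_neq0.
Qed.

Section PolynomialAction.

Variables (K : numFieldType) (n : nat).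
Implicit Types (lam : 'I_n -> K) (p q t u : {mpoly K[n]}).

Lemma act_gen_sl2 lam i : sl2_action (act_gen lam i).
Proof.
split=> [g | p | p]; first exact: act_gen_linear.
- by apply/eqP; rewrite addrC -subr_eq; apply/eqP; exact: (act_HE lam i p).
- by rewrite -[act_gen lam i gH p](act_EF lam i p) opprB [RHS]addrC subrK.
Qed.

Lemma act_gen_commuting lam i j :
  i != j -> commuting (act_gen lam i) (act_gen lam j).
Proof. by move=> ij g h p; apply: (act_comm lam g h p ij). Qed.

Lemma act_gen_lowest lam i : lowest (act_gen lam i) (lam i) 1.
Proof.
by split; rewrite /= mderivC ?mderiv0 ?mulr0 ?scaler0 ?oppr0 ?subr0 ?addr0.
Qed.

(** Checked in the fraction field, where the rational argument makes sense and into which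
    polynomials embed. *)
Lemma homogenize_jacobi a b m t u : t + u != 0 ->
  homogenize m (jacobi a b m) (u - t) (t + u)
  = \sum_(s < m.+1) jacobi_coef a b m s *: (t ^+ s * u ^+ (m - s)).
Proof.
move=> w0; apply/eqP; rewrite -tofrac_eq; apply/eqP.
pose f : {rmorphism K -> {fraction {mpoly K[n]}}} := (@tofrac _ \o @mpolyC n K).
rewrite tofrac_homogenize ?size_jacobi // /eval_frac -[map_poly _ _]/(map_poly f _).
rewrite tofracB tofracD horner_jacobi -?tofracD ?tofrac_eq0 // rmorph_sum.
apply: eq_bigr => s _ /=.
by rewrite -mul_mpolyC !tofracM !tofracXn.
Qed.

(** Bridge from the abstract construction to the explicit vectors: here the raising operators are
    multiplications. *)
Lemma jacobi_vec_mul (rho sigma : sl2_gen -> {mpoly K[n]} -> {mpoly K[n]})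
    a b m p t u :
  (forall q, rho gE q = t * q) -> (forall q, sigma gE q = u * q) ->
  t + u != 0 ->
  jacobi_vec rho sigma a b m p = homogenize m (jacobi a b m) (u - t) (t + u) * p.
Proof.
move=> rE sE w0; rewrite homogenize_jacobi // mulr_suml; apply: eq_bigr => s _.
by rewrite (eq_iter rE) (eq_iter sE) !iter_mulr -scalerAl mulrA.
Qed.

Lemma meval_homogenize_jacobi (e : 'I_n -> K) a b m t u : t + u != 0 ->
  (homogenize m (jacobi a b m) (u - t) (t + u)).@[e]
  = \sum_(s < m.+1) jacobi_coef a b m s * (t.@[e] ^+ s * u.@[e] ^+ (m - s)).
Proof.
move=> w0; rewrite homogenize_jacobi // raddf_sum; apply: eq_bigr => s _ /=.
by rewrite mevalZ mevalM !rmorphXn.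
Qed.

End PolynomialAction.

(** * Nonvanishing of the Jacobi polynomials at the endpoints 1 and -1 *)

Section Nonvanishing.

Variable K : numFieldType.
Implicit Types a b : K.

Lemma gbinom_neq0 a m N : avoids a (N - 1) -> (m <= N)%N ->
  gbinom (m%:R + a - 1) m != 0.
Proof.
move=> ha mN; rewrite /gbinom mulf_neq0 ?invr_eq0 ?pnatr_eq0 -?lt0n ?fact_gt0 //.
apply/prodf_neq0 => i _; apply/eqP => E.
(* The factor of index i in the numerator is a + (m - i - 1). *)
apply: (ha (m - i.+1)%N); first by apply: leq_sub; rewrite ?mN.
apply/eqP; rewrite -addr_eq0 natrB ?ltn_ord // -E; apply/eqP; ring.
Qed.

(** As [0 ^+ 0] is 1, only s = 0 survives; t = 0 corresponds to the argument 1, and u = 0 below to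
    -1. *)
Lemma jacobi_sum_t0 a b m (u : K) :
  \sum_(s < m.+1) jacobi_coef a b m s * (0 ^+ s * u ^+ (m - s))
  = gbinom (m%:R + a - 1) m * u ^+ m.
Proof.
rewrite big_ord_recl big1 => [|i _]; last by rewrite lift0 expr0n mul0r mulr0.
by rewrite /jacobi_coef /gbinom big_ord0 fact0 invr1 subn0 addr0 /=; ring.
Qed.

Lemma jacobi_sum_u0 a b m (t : K) :
  \sum_(s < m.+1) jacobi_coef a b m s * (t ^+ s * 0 ^+ (m - s))
  = (-1) ^+ m * gbinom (m%:R + b - 1) m * t ^+ m.
Proof.
rewrite big_ord_recr big1 /= => [|i _]; last first.
  by rewrite expr0n subn_eq0 leqNgt ltn_ord mulr0 mulr0.
by rewrite /jacobi_coef subnn /gbinom big_ord0 fact0 invr1; ring.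
Qed.

End Nonvanishing.

(** * Coupling of the three Verma modules *)

Section Coupling.

Variables (K : numFieldType) (lam1 lam2 lam3 : K).
Let lam := weights lam1 lam2 lam3.
Let rho i := act_gen lam i.
Implicit Types (p : {mpoly K[3]}) (c mu : K).

(** These equalities identify the tensor positions used by [tens_one] and [one_tens] with the
    variables they act on. *)
Let ord3E0 : widen_ord (leqnSn 2) 0 = 0 :> 'I_3. Proof. exact: val_inj. Qed.
Let ord3E1 : widen_ord (leqnSn 2) 1 = 1 :> 'I_3. Proof. exact: val_inj. Qed.
Let ord3L0 : lift ord0 (0 : 'I_2) = 1 :> 'I_3. Proof. exact: val_inj. Qed.
Let ord3L1 : lift ord0 (1 : 'I_2) = 2%:R :> 'I_3. Proof. exact: val_inj. Qed.

Lemma act_C12 c p :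
  act lam (Ushift (C12 K) c) p
  = cas (sum_action (rho 0) (rho 1)) p - (c * (c - 2%:R) / 4%:R) *: p.
Proof. by rewrite /= ord3E0 ord3E1 scaleNr. Qed.

Lemma act_C23 c p :
  act lam (Ushift (C23 K) c) p
  = cas (sum_action (rho 1) (rho 2%:R)) p - (c * (c - 2%:R) / 4%:R) *: p.
Proof. by rewrite /= ord3L0 ord3L1 scaleNr. Qed.

Lemma act_C123 c p :
  act lam (Ushift (C123 K) c) p
  = cas (sum_action (sum_action (rho 0) (rho 1)) (rho 2%:R)) p
    - (c * (c - 2%:R) / 4%:R) *: p.
Proof. by rewrite /= scaleNr. Qed.

(** The shifts in X, Y and C' subtract the Casimir value at weight c from that at weight c + 2k; the
    difference factors as k(k + c - 1). *)
Lemma casimir_shift (T : {mpoly K[3]} -> {mpoly K[3]}) c (k : nat) p :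
  T p = ((c + (2 * k)%:R) * (c + (2 * k)%:R - 2%:R) / 4%:R) *: p ->
  T p - (c * (c - 2%:R) / 4%:R) *: p = (k%:R * (k%:R + c - 1)) *: p.
Proof. by move=> ->; rewrite -scalerBl natrM; congr (_ *: _); field. Qed.

Lemma commuting_sumr (rho1 rho2 tau : sl2_gen -> {mpoly K[3]} -> {mpoly K[3]}) :
  (forall g, linear (tau g)) ->
  commuting tau rho1 -> commuting tau rho2 -> commuting tau (sum_action rho1 rho2).
Proof.
move=> lt t1 t2; apply: commuting_sym; apply: commuting_suml => //;
  exact: commuting_sym.
Qed.

Let rhoP i : sl2_action (rho i) := act_gen_sl2 lam i.
Let rho01 : commuting (rho 0) (rho 1). Proof. exact: act_gen_commuting. Qed.
Let rho02 : commuting (rho 0) (rho 2%:R). Proof. exact: act_gen_commuting. Qed.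
Let rho12 : commuting (rho 1) (rho 2%:R). Proof. exact: act_gen_commuting. Qed.
Let rho01P := sum_actionP (rhoP 0) (rhoP 1) rho01.
Let rho12P := sum_actionP (rhoP 1) (rhoP 2%:R) rho12.
Let rho01_2 := commuting_suml (sl2_linear (rhoP 2%:R)) rho02 rho12.
Let rho0_12 := commuting_sumr (sl2_linear (rhoP 0)) rho01 rho02.

Let low0 : lowest (rho 0) lam1 1. Proof. exact: act_gen_lowest. Qed.
Let low1 : lowest (rho 1) lam2 1. Proof. exact: act_gen_lowest. Qed.
Let low2 : lowest (rho 2%:R) lam3 1. Proof. exact: act_gen_lowest. Qed.

Let x : {mpoly K[3]} := varx K.
Let y : {mpoly K[3]} := vary K.
Let z : {mpoly K[3]} := varz K.

Lemma v_vecE N l : v_vec lam1 lam2 lam3 N l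
  = jacobi_vec (sum_action (rho 0) (rho 1)) (rho 2%:R)
      (lam1 + lam2 + (2 * l)%:R) lam3 (N - l)
      (jacobi_vec (rho 0) (rho 1) lam1 lam2 l 1).
Proof.
have [h1 h2 _] := vars_neq0 K.
rewrite (@jacobi_vec_mul _ _ _ _ _ _ _ _ (x + y) z) //; last first.
  by move=> q; rewrite mulrDl.
by rewrite (@jacobi_vec_mul _ _ _ _ _ _ _ _ x y) // mulr1.
Qed.

Lemma w_vecE N l : w_vec lam1 lam2 lam3 N l
  = jacobi_vec (rho 0) (sum_action (rho 1) (rho 2%:R))
      lam1 (lam2 + lam3 + (2 * l)%:R) (N - l)
      (jacobi_vec (rho 1) (rho 2%:R) lam2 lam3 l 1).
Proof.
have [h1 _ h2] := vars_neq0 K; rewrite -addrA in h1.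
rewrite (@jacobi_vec_mul _ _ _ _ _ _ _ _ x (y + z)) //; last first.
  by move=> q; rewrite mulrDl.
by rewrite (@jacobi_vec_mul _ _ _ _ _ _ _ _ y z) // mulr1 addrA.
Qed.

Let lowest01 l := lowest_jacobi_vec l (rhoP 0) (rhoP 1) rho01 low0 low1.
Let lowest12 l := lowest_jacobi_vec l (rhoP 1) (rhoP 2%:R) rho12 low1 low2.

Lemma opX_v_vec N l :
  opX lam1 lam2 lam3 (v_vec lam1 lam2 lam3 N l)
  = (l%:R * (l%:R + lam1 + lam2 - 1)) *: v_vec lam1 lam2 lam3 N l.
Proof.
rewrite /opX act_C12 -[_ + lam1 + lam2]addrA; apply: casimir_shift; rewrite v_vecE.
(* The Casimir of (1, 2) commutes with the coupled raising operator by [cas_E] and with that of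
   factor 3 by [cas_comm], so only the inner vector, of weight lam1 + lam2 + 2l, matters. *)
apply: jacobi_vec_eigen; [exact: cas_linear | exact: sl2_linear rho01P gE
  | exact: sl2_linear | exact: cas_E | |].
  by apply: cas_comm => //; exact: sl2_linear.
exact: (cas_lowest rho01P (lowest01 l)).
Qed.

Lemma opY_w_vec N l :
  opY lam1 lam2 lam3 (w_vec lam1 lam2 lam3 N l)
  = (l%:R * (l%:R + lam2 + lam3 - 1)) *: w_vec lam1 lam2 lam3 N l.
Proof.
rewrite /opY act_C23 -[_ + lam2 + lam3]addrA; apply: casimir_shift; rewrite w_vecE.
apply: jacobi_vec_eigen; [exact: cas_linear | exact: sl2_linear
  | exact: sl2_linear rho12P gE | | exact: cas_E |].
  by apply: cas_comm; [exact: sl2_linear | exact: commuting_sym].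
exact: (cas_lowest rho12P (lowest12 l)).
Qed.

Lemma opC123_lowest N p :
  lowest (sum_action (sum_action (rho 0) (rho 1)) (rho 2%:R))
    (lam1 + lam2 + lam3 + (2 * N)%:R) p ->
  opC123' lam1 lam2 lam3 p = (N%:R * (lam1 + lam2 + lam3 + N%:R - 1)) *: p.
Proof.
move=> Lp; rewrite /opC123' act_C123 [_ + N%:R]addrC; apply: casimir_shift.
exact: cas_lowest (sum_actionP rho01P (rhoP 2%:R) rho01_2) Lp.
Qed.

Lemma opC123_v_vec N l : (l <= N)%N ->
  opC123' lam1 lam2 lam3 (v_vec lam1 lam2 lam3 N l)
  = (N%:R * (lam1 + lam2 + lam3 + N%:R - 1)) *: v_vec lam1 lam2 lam3 N l.
Proof.
move=> lN; apply: opC123_lowest; rewrite v_vecE.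
have -> : lam1 + lam2 + lam3 + (2 * N)%:R
  = lam1 + lam2 + (2 * l)%:R + lam3 + (2 * (N - l))%:R.
  by rewrite -[in LHS](subnKC lN); ring.
apply: (lowest_jacobi_vec _ rho01P (rhoP 2%:R) rho01_2) (lowest01 l) _.
by apply: lowest_jacobi_vec_comm => //; exact: commuting_sym.
Qed.

Lemma opC123_w_vec N l : (l <= N)%N ->
  opC123' lam1 lam2 lam3 (w_vec lam1 lam2 lam3 N l)
  = (N%:R * (lam1 + lam2 + lam3 + N%:R - 1)) *: w_vec lam1 lam2 lam3 N l.
Proof.
move=> lN; apply: opC123_lowest; rewrite w_vecE.
have -> : lam1 + lam2 + lam3 + (2 * N)%:R
  = lam1 + (lam2 + lam3 + (2 * l)%:R) + (2 * (N - l))%:R.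
  by rewrite -[in LHS](subnKC lN); ring.
apply: lowest_sum_actionA.
apply: (lowest_jacobi_vec _ (rhoP 0) rho12P rho0_12) _ (lowest12 l).
by apply: lowest_jacobi_vec_comm.
Qed.

(** At (0, 1, 0) the outer factor has u = z = 0 and the inner one t = x = 0, which leaves, up to
    sign, a product of binomials in lam3 and lam1. *)
Lemma v_vec_neq0 N l : avoids lam1 (N - 1) -> avoids lam3 (N - 1) ->
  (l <= N)%N -> v_vec lam1 lam2 lam3 N l != 0.
Proof.
move=> h1 h3 lN; have [hxyz hxy _] := vars_neq0 K.
pose e : 'I_3 -> K := fun i => (i == 1)%:R.
have ex : x.@[e] = 0 by rewrite mevalXU.
have ey : y.@[e] = 1 by rewrite mevalXU.
have ez : z.@[e] = 0 by rewrite mevalXU.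
apply/eqP => /(congr1 (meval e)) /eqP; apply/negP.
rewrite meval0 /v_vec mevalM !meval_homogenize_jacobi // mevalD ex ey ez add0r.
rewrite jacobi_sum_u0 jacobi_sum_t0 !expr1n !mulr1.
apply: mulf_neq0 (gbinom_neq0 h1 lN); rewrite mulf_eq0 signr_eq0 orFb.
exact: gbinom_neq0 h3 (leq_subr _ _).
Qed.

(** At (0, 0, 1) both factors have t = 0, which leaves binomials in lam1 and lam2. *)
Lemma w_vec_neq0 N l : avoids lam1 (N - 1) -> avoids lam2 (N - 1) ->
  (l <= N)%N -> w_vec lam1 lam2 lam3 N l != 0.
Proof.
move=> h1 h2 lN; have [hxyz _ hyz] := vars_neq0 K; rewrite -addrA in hxyz.
pose e : 'I_3 -> K := fun i => (i == 2%:R)%:R.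
have ex : x.@[e] = 0 by rewrite mevalXU.
have ey : y.@[e] = 0 by rewrite mevalXU.
have ez : z.@[e] = 1 by rewrite mevalXU.
apply/eqP => /(congr1 (meval e)) /eqP; apply/negP.
rewrite meval0 /w_vec -[varx K + _ + _]addrA mevalM !meval_homogenize_jacobi //.
rewrite mevalD ex ey ez add0r !jacobi_sum_t0 !expr1n !mulr1.
exact: mulf_neq0 (gbinom_neq0 h1 (leq_subr _ _)) (gbinom_neq0 h2 lN).
Qed.

End Coupling.

Theorem proposition4p6 (R : realType) (N : nat) (lam1 lam2 lam3 : R[i])
    (hN : (1 <= N)%N)
    (h1 : avoids lam1 (N - 1)) (h2 : avoids lam2 (N - 1))
    (h3 : avoids lam3 (N - 1))
    (h12 : avoids (lam1 + lam2) (2 * N - 2))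
    (h23 : avoids (lam2 + lam3) (2 * N - 2))
    (h123 : avoids (lam1 + lam2 + lam3) (2 * N - 2)) :
  forall l : nat, (l <= N)%N ->
    let v := v_vec lam1 lam2 lam3 N l in
    let w := w_vec lam1 lam2 lam3 N l in
    let X := opX lam1 lam2 lam3 in
    let Y := opY lam1 lam2 lam3 in
    let C' := opC123' lam1 lam2 lam3 in
    [/\ eigenvector X (l%:R * (l%:R + lam1 + lam2 - 1)) v,
        eigenvector Y (l%:R * (l%:R + lam2 + lam3 - 1)) w,
        eigenvector C' (N%:R * (lam1 + lam2 + lam3 + N%:R - 1)) v
      & eigenvector C' (N%:R * (lam1 + lam2 + lam3 + N%:R - 1)) w].
Proof.
move=> l lN v w X Y C'; split; split.
- exact/eqP/v_vec_neq0.
- exact: opX_v_vec.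
- exact/eqP/w_vec_neq0.
- exact: opY_w_vec.
- exact/eqP/v_vec_neq0.
- exact: opC123_v_vec.
- exact/eqP/w_vec_neq0.
- exact: opC123_w_vec.
Qed.
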